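(* Let $\mathcal{U}=\{u_1,\dots,u_N\}$ be a weighted SVD basis of $\mathcal{N}_\Phi(X)$, let $M\le N$, and let $f\in\mathcal{N}_\Phi(\Omega)$. Then for all $x\in\Omega$ $$|P_X[f](x)|\le\sqrt{\phi(0)}\,\|f\|_\Phi,\qquad |\Lambda_M[f](x)|\le\sqrt{\phi(0)}\,\|f\|_\Phi,$$ where in particular, for all $x\in\Omega$, $$|P_X[f](x)|\le\sqrt{\sum_{j=1}^N u_j(x)^2}\;\|f\|_\Phi,\qquad |\Lambda_M[f](x)|\le\sqrt{\sum_{j=1}^M u_j(x)^2}\;\|f\|_\Phi .$$
   Context: Let $\Omega\subset\mathbb{R}^n$ be a bounded measurable set with Lebesgue measure $|\Omega|$, and let $\Phi:\Omega\times\Omega\to\mathbb{R}$ be a continuous, symmetric, radial kernel, $\Phi(x,y)=\phi(\|x-y\|_2)$ with $\phi:[0,\infty)\to\mathbb{R}$, that is (strictly) positive definite: for all finite sets of pairwise distinct points the matrix of kernel values is positive definite. The native space $\mathcal{N}_\Phi(\Omega)$ is the real Hilbert space of functions on $\Omega$ with reproducing kernel $\Phi$, with inner product $(\cdot,\cdot)_\Phi$ and norm $\|\cdot\|_\Phi$. For a set $X=\{x_1,\dots,x_N\}\subset\Omega$ of pairwise distinct points, $\mathcal{N}_\Phi(X)=\mathrm{span}\{\Phi(\cdot,x_1),\dots,\Phi(\cdot,x_N)\}$ and $A=(\Phi(x_i,x_j))_{1\le i,j\le N}$. Let $\mathcal{W}=\{w_1,\dots,w_N\}$ be positive weights of a cubature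 rule $(X,\mathcal{W})_N$ on $\Omega$, assumed exact on constants, i.e. $\sum_{j=1}^N w_j=|\Omega|$. Put $W=\mathrm{diag}(w_1,\dots,w_N)$ and $(f,g)_{\ell_2^w(X)}=\sum_{i=1}^N w_i f(x_i)g(x_i)$, with $\|f\|_{\ell_2^w(X)}^2=(f,f)_{\ell_2^w(X)}$. Weighted SVD basis: let $\sqrt{W}\,A\,\sqrt{W}=Q\,\Sigma^2\,Q^T$ be a singular value decomposition (equivalently, an orthogonal diagonalization), with $Q$ orthogonal and $\Sigma=\mathrm{diag}(\sigma_1,\dots,\sigma_N)$, $\sigma_1\ge\dots\ge\sigma_N>0$. The associated weighted SVD basis $\mathcal{U}=\{u_1,\dots,u_N\}$ of $\mathcal{N}_\Phi(X)$ is given by $u_j=\sum_{i=1}^N (C_{\mathcal U})_{ij}\,\Phi(\cdot,x_i)$ with $C_{\mathcal U}=\sqrt{W}\,Q\,\Sigma^{-1}$; equivalently $(u_j(x_i))_{i,j}=\sqrt{W^{-1}}\,Q\,\Sigma$. For $f\in\mathcal{N}_\Phi(\Omega)$, $P_X[f]$ denotes the unique element of $\mathcal{N}_\Phi(X)$ with $P_X[f](x_i)=f(x_i)$ for $i=1,\dots,N$, and $\Lambda_M[f]=\arg\min_{g\in\mathrm{span}\{u_1,\dots,u_M\}}\|f-g\|_{\ell_2^w(X)}$ is the weighted least-squares approximant of order $M\le N$. *)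

(* Defs.v *)
From HB Require Import structures.
From mathcomp Require Import all_boot all_order all_algebra.
From mathcomp Require Import all_classical all_reals all_analysis.

Set Implicit Arguments.
Unset Strict Implicit.
Unset Printing Implicit Defensive.

Import Order.TTheory GRing.Theory Num.Theory.
Import numFieldNormedType.Exports.
Local Open Scope classical_set_scope.
Local Open Scope ring_scope.

(* The norm that MathComp-Analysis puts on 'rV[R]_n is the maximum norm. *)
Definition enorm (R : realType) (n : nat) (v : 'rV[R]_n) : R :=
  Num.sqrt (\sum_(i < n) v ord0 i ^+ 2).

Section LebesgueMeasure.
Context (R : realType) (n : nat).

Definition box (ab : 'rV[R]_n * 'rV[R]_n) : set 'rV[R]_n :=
  [set v | forall i, ab.1 ord0 i <= v ord0 i <= ab.2 ord0 i].

Definition box_volume (ab : 'rV[R]_n * 'rV[R]_n) : R :=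
  \prod_(i < n) (ab.2 ord0 i - ab.1 ord0 i).

Definition box_cover (A : set 'rV[R]_n) : set (nat -> 'rV[R]_n * 'rV[R]_n) :=
  [set F : nat -> 'rV[R]_n * 'rV[R]_n |
    (forall k i, (F k).1 ord0 i <= (F k).2 ord0 i) /\ A `<=` \bigcup_k box (F k)].

(* Only meaningful for 0 < n: in dimension 0 every box has volume 1, so that
   every countable cover has infinite total volume. *)
Definition lebesgue_outer (A : set 'rV[R]_n) : \bar R :=
  ereal_inf [set (\sum_(k <oo) (box_volume (F k))%:E)%E | F in box_cover A].

(* On these sets |A| is the outer measure of A. *)
Definition lebesgue_measurable : set (set 'rV[R]_n) :=
  lebesgue_outer.-caratheodory.

End LebesgueMeasure.

Definition posdefmx (R : realType) (m : nat) (A : 'M[R]_m) : Prop :=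
  A^T = A /\ forall v : 'rV[R]_m, v != 0 -> 0 < (v *m A *m v^T) ord0 ord0.

Section Kernel.
Context (R : realType) (T : Type) (K : T -> T -> R).

Definition kernel_mx (m : nat) (x : 'I_m -> T) : 'M[R]_m :=
  \matrix_(i, j) K (x i) (x j).

Definition posdef_kernel : Prop :=
  forall (m : nat) (x : 'I_m -> T), injective x -> posdefmx (kernel_mx x).

(* The inner product is a total function on T -> R of which only the values on
   the carrier matter. By the Moore-Aronszajn theorem the carrier and these
   values are determined by K. *)
Record native_space := NativeSpace {
  native_carrier : set (T -> R);
  native_ip : (T -> R) -> (T -> R) -> R;
  native_norm (f : T -> R) : R := Num.sqrt (native_ip f f);
  native_0 : native_carrier 0;
  native_lin : forall a f g,
    native_carrier f -> native_carrier g -> native_carrier (a *: f + g);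
  native_ip_sym : forall f g,
    native_carrier f -> native_carrier g -> native_ip f g = native_ip g f;
  native_ip_lin : forall a f g h,
    native_carrier f -> native_carrier g -> native_carrier h ->
    native_ip (a *: f + g) h = a * native_ip f h + native_ip g h;
  native_ip_gt0 : forall f, native_carrier f -> f != 0 -> 0 < native_ip f f;
  native_complete : forall s : nat -> T -> R,
    (forall k, native_carrier (s k)) ->
    (forall e, 0 < e -> exists k0, forall k l,
       (k0 <= k)%N -> (k0 <= l)%N -> native_norm (s k - s l) < e) ->
    exists2 f, native_carrier f & native_norm (s k - f) @[k --> \oo] --> 0;
  native_kernel : forall y, native_carrier (K^~ y);
  native_repr : forall f y, native_carrier f -> native_ip f (K^~ y) = f y
}.

Section Approximation.
Context (N : nat).
Implicit Types (x : 'I_N -> T) (w : 'I_N -> R) (u : 'I_N -> T -> R).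
Implicit Types (f g : T -> R).

Definition trial_space x : set (T -> R) :=
  [set g | exists c : 'I_N -> R, g = \sum_i c i *: K^~ (x i)].

Definition diagf (d : 'I_N -> R) : 'M[R]_N := diag_mx (\row_i d i).

Definition weighted_svd x w (Q : 'M[R]_N) (sigma : 'I_N -> R) : Prop :=
  let sqrtW := diagf (fun i => Num.sqrt (w i)) in
  let Sigma := diagf sigma in
  [/\ Q^T *m Q = 1%:M,
      forall i j : 'I_N, (i <= j)%N -> sigma j <= sigma i,
      forall i, 0 < sigma i &
      sqrtW *m kernel_mx x *m sqrtW = Q *m (Sigma *m Sigma) *m Q^T].

Definition weighted_svd_basis x w u : Prop :=
  exists Q sigma, weighted_svd x w Q sigma /\
    let C := diagf (fun i => Num.sqrt (w i)) *m Q *m invmx (diagf sigma) in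
    forall j, u j = \sum_i C i j *: K^~ (x i).

Definition wip x w f g : R := \sum_i w i * f (x i) * g (x i).

Definition wnorm x w f : R := Num.sqrt (wip x w f f).

Definition span_lt u (M : nat) : set (T -> R) :=
  [set g | exists c : 'I_N -> R, g = \sum_(j < N | (j < M)%N) c j *: u j].

Definition is_interpolant x f : set (T -> R) :=
  [set g | trial_space x g /\ forall i, g (x i) = f (x i)].

Definition is_wls x w u (M : nat) f : set (T -> R) :=
  [set g | span_lt u M g /\
           forall h, span_lt u M h -> wnorm x w (f - g) <= wnorm x w (f - h)].

(* interpolant_unique and wls_approx_unique below show that, for a positive
   definite K, distinct points and positive weights, the default value 0 of
   these choices is never used and that the function chosen is the only one. *)
Definition interpolant x f : T -> R := xget 0 (is_interpolant x f).

Definition wls_approx x w u (M : nat) f : T -> R := xget 0 (is_wls x w u M f).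

End Approximation.
End Kernel.

Section WellDefined.
Context (R : realType) (T : Type) (K : T -> T -> R).
Context (N : nat) (x : 'I_N -> T) (w : 'I_N -> R).
Implicit Types (f g h : T -> R) (c d : 'I_N -> R).

Lemma combE (P : pred 'I_N) c (v : 'I_N -> T -> R) y :
  (\sum_(j | P j) c j *: v j) y = \sum_(j | P j) c j * v j y.
Proof. by rewrite fct_sumE. Qed.

Lemma trial_at c k :
  (\sum_i c i *: K^~ (x i)) (x k) = ((\row_i c i) *m (kernel_mx K x)^T) ord0 k.
Proof.
by rewrite combE mxE; apply: eq_bigr => i _; rewrite !mxE.
Qed.

Lemma interpolant_unique f : posdef_kernel K -> injective x ->
  is_interpolant K x f = [set interpolant K x f].
Proof.
move=> Kpos xinj; have [Asym Apos] := Kpos _ _ xinj.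
have Aunit : kernel_mx K x \in unitmx.
  rewrite -row_free_unit -kermx_eq0; apply/rowV0P => v /sub_kermxP vA.
  by apply/eqP; apply: contraT => /Apos; rewrite vA mul0mx mxE ltxx.
have uniq g h : is_interpolant K x f g -> is_interpolant K x f h -> g = h.
  move=> [[c ->] gf] [[d ->] hf].
  have /(can_inj (mulmxK Aunit)) cd :
      (\row_i c i) *m kernel_mx K x = (\row_i d i) *m kernel_mx K x.
    by apply/rowP => k; rewrite -Asym -!trial_at gf hf.
  apply: eq_bigr => i _; congr (_ *: _).
  by have := congr1 (fun v : 'rV[R]_N => v ord0 i) cd; rewrite !mxE.
pose v := (\row_i f (x i)) *m invmx (kernel_mx K x).
have ex : is_interpolant K x f (\sum_i v ord0 i *: K^~ (x i)).
  split; first by exists (v ord0).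
  move=> k; rewrite trial_at (_ : \row_i v ord0 i = v).
    by rewrite Asym mulmxKV// mxE.
  by apply/rowP => i; rewrite mxE.
have Pi : is_interpolant K x f (interpolant K x f).
  exact: xgetPex (ex_intro _ _ ex).
by apply/seteqP; split=> [g /uniq|_ ->]; [exact|exact: Pi].
Qed.

Lemma wipC f g : wip x w f g = wip x w g f.
Proof. by apply: eq_bigr => i _; rewrite mulrAC. Qed.

Lemma wipD f g h : wip x w f (g + h) = wip x w f g + wip x w f h.
Proof. by rewrite -big_split; apply: eq_bigr => i _; rewrite /= mulrDr. Qed.

Lemma wipN f g : wip x w f (- g) = - wip x w f g.
Proof. by rewrite -sumrN; apply: eq_bigr => i _; rewrite /= mulrN. Qed.

Lemma wip_pyth f g : wip x w f g = 0 ->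
  wip x w (f + g) (f + g) = wip x w f f + wip x w g g.
Proof.
move=> fg0; rewrite wipD (wipC _ f) wipD fg0 addr0 (wipC _ g) wipD.
by rewrite (wipC g f) fg0 add0r.
Qed.

Lemma wip_comb (P : pred 'I_N) f c (v : 'I_N -> T -> R) :
  wip x w f (\sum_(j | P j) c j *: v j) = \sum_(j | P j) c j * wip x w f (v j).
Proof.
rewrite /wip; under eq_bigr => i _ do rewrite combE mulr_sumr.
rewrite exchange_big; apply: eq_bigr => j _; rewrite mulr_sumr.
by apply: eq_bigr => i _; rewrite mulrCA.
Qed.

Lemma diagf_mul (a b : 'I_N -> R) : diagf a *m diagf b = diagf (fun i => a i * b i).
Proof.
by rewrite /diagf mulmx_diag; congr diag_mx; apply/rowP => i; rewrite !mxE.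
Qed.

Lemma diagf_inv (a : 'I_N -> R) : (forall i, 0 < a i) ->
  invmx (diagf a) = diagf (fun i => (a i)^-1).
Proof.
move=> a0; have dV : diagf (fun i => (a i)^-1) *m diagf a = 1%:M.
  rewrite diagf_mul; apply/matrixP => i j; rewrite !mxE mulVf//.
  by rewrite gt_eqF.
have [aU _] := mulmx1_unit (mulmx1C dV).
by rewrite -[RHS](mulmxK aU) dV mul1mx.
Qed.

Lemma svd_basis_gram (u : 'I_N -> T -> R) : posdef_kernel K -> injective x ->
  (forall i, 0 < w i) -> weighted_svd_basis K x w u ->
  exists2 s : 'I_N -> R, forall j, 0 < s j &
    forall j k, wip x w (u j) (u k) = s j *+ (j == k).
Proof.
move=> Kpos xinj w0 [Q [sg [[QQ _ sg0 SAS] uE]]].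
have [Asym _] := Kpos _ _ xinj.
exists (fun j => sg j * sg j) => [j|j k]; first by rewrite mulr_gt0.
move: SAS uE; set S := diagf _; set A := kernel_mx K x => SAS uE.
pose C := S *m Q *m invmx (diagf sg).
have AC : A *m C = \matrix_(i, l) u l (x i).
  apply/matrixP => i l; rewrite !mxE uE combE.
  by apply: eq_bigr => m _; rewrite !mxE mulrC.
have -> : wip x w (u j) (u k) = ((A *m C)^T *m diagf w *m (A *m C)) j k.
  rewrite AC /diagf mul_mx_diag mxE; apply: eq_bigr => i _.
  by rewrite !mxE (mulrC (w i)).
have WS : diagf w = S *m S.
  rewrite diagf_mul; congr diagf; apply/funext => i.
  by rewrite -expr2 sqr_sqrtr// ltW.
have ST : S^T = S by rewrite tr_diag_mx.
have IT : (invmx (diagf sg))^T = invmx (diagf sg).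
  by rewrite diagf_inv// tr_diag_mx.
have sgU : diagf sg \in unitmx.
  have : invmx (diagf sg) *m diagf sg = 1%:M.
    rewrite diagf_inv// diagf_mul; apply/matrixP => a b; rewrite !mxE mulVf//.
    by rewrite gt_eqF.
  by move=> /mulmx1C/mulmx1_unit[].
have -> : (A *m C)^T *m diagf w *m (A *m C) = invmx (diagf sg) *m Q^T *m
    (S *m A *m S) *m (S *m A *m S) *m Q *m invmx (diagf sg).
  by rewrite WS /C !trmx_mul ST IT Asym !mulmxA.
have QK (X : 'M[R]_N) : X *m Q^T *m Q = X by rewrite -mulmxA QQ mulmx1.
rewrite SAS !mulmxA !QK mulVmx// mul1mx -!mulmxA mulmxV// mulmx1.
by rewrite diagf_mul !mxE.
Qed.

Lemma wls_approx_unique (u : 'I_N -> T -> R) (M : nat) f :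
  posdef_kernel K -> injective x -> (forall i, 0 < w i) ->
  weighted_svd_basis K x w u ->
  is_wls x w u M f = [set wls_approx x w u M f].
Proof.
move=> Kpos xinj w0 /(svd_basis_gram Kpos xinj w0)[s s0 uu].
pose c j := wip x w f (u j) / s j.
pose g := \sum_(j < N | (j < M)%N) c j *: u j.
have orth (j : 'I_N) : (j < M)%N -> wip x w (u j) (f - g) = 0.
  move=> jM; rewrite wipD wipN wip_comb (bigD1 j)//= big1 ?addr0.
    by rewrite uu eqxx mulr1n divfK ?gt_eqF// wipC subrr.
  by move=> i /andP[_ ij]; rewrite uu eq_sym (negbTE ij) mulr0n mulr0.
have sq d : wip x w (f - \sum_(j < N | (j < M)%N) d j *: u j)
      (f - \sum_(j < N | (j < M)%N) d j *: u j) =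
    wip x w (f - g) (f - g) + \sum_(j < N | (j < M)%N) (c j - d j) ^+ 2 * s j.
  have -> : f - \sum_(j < N | (j < M)%N) d j *: u j =
      (f - g) + \sum_(j < N | (j < M)%N) (c j - d j) *: u j.
    under [in RHS]eq_bigr => j _ do rewrite scalerBl.
    by rewrite sumrB addrA subrK.
  set e := (X in _ + X).
  have eg : wip x w (f - g) e = 0.
    by rewrite wip_comb big1// => j jM; rewrite wipC orth// mulr0.
  rewrite wip_pyth//; congr (_ + _).
  rewrite wip_comb; apply: eq_bigr => j jM.
  rewrite wipC wip_comb (bigD1 j)//= big1 ?addr0.
    by rewrite uu eqxx mulr1n mulrA expr2.
  by move=> i /andP[_ ij]; rewrite uu eq_sym (negbTE ij) mulr0n mulr0.
have rge0 d : 0 <= \sum_(j < N | (j < M)%N) (c j - d j) ^+ 2 * s j.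
  by apply: sumr_ge0 => j _; rewrite mulr_ge0 ?sqr_ge0// ltW.
have wge0 h : 0 <= wip x w h h.
  by apply: sumr_ge0 => i _; rewrite -mulrA -expr2 mulr_ge0 ?sqr_ge0// ltW.
have gP : is_wls x w u M f g.
  split; first by exists c.
  by move=> _ [d ->]; rewrite ler_sqrt ?wge0// (sq d) lerDl.
have uniq h : is_wls x w u M f h -> h = g.
  move=> [[d ->] /(_ g gP.1)]; rewrite ler_sqrt ?wge0// (sq d) gerDl => le0.
  have /eqP : \sum_(j < N | (j < M)%N) (c j - d j) ^+ 2 * s j = 0.
    by apply/eqP; rewrite eq_le le0 rge0.
  rewrite psumr_eq0 => [/allP d0|j _]; last by rewrite mulr_ge0 ?sqr_ge0// ltW.
  apply: eq_bigr => j jM; congr (_ *: _); apply/esym/eqP.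
  have := d0 j (mem_index_enum j); rewrite jM /= mulf_eq0 (gt_eqF (s0 j)) orbF.
  by rewrite sqrf_eq0 subr_eq0.
have -> : wls_approx x w u M f = g.
  by apply/uniq; exact: xgetPex (ex_intro _ _ gP).
by apply/seteqP; split=> [h /uniq|_ ->].
Qed.

End WellDefined.

(* Main.v *)
Require Import Defs.
From HB Require Import structures.
From mathcomp Require Import all_boot all_order all_algebra.
From mathcomp Require Import all_classical all_reals all_analysis.
From mathcomp Require Import ring.

Set Implicit Arguments.
Unset Strict Implicit.
Unset Printing Implicit Defensive.

Import Order.TTheory GRing.Theory Num.Theory.
Import numFieldNormedType.Exports.
Local Open Scope classical_set_scope.
Local Open Scope ring_scope.

(** A weighted SVD basis is orthonormal in the native space, and
    (f, u_j)_{l_2^w(X)} = sigma_j^2 (f, u_j)_Phi. Both approximants are therefore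
    partial sums of the native-space Fourier series of f in this basis:
    Lambda_M[f] = sum_(j < M) (f, u_j)_Phi u_j, and P_X[f] is the same sum over
    all j. Cauchy-Schwarz and Bessel's inequality for f give the pointwise bounds;
    Bessel's inequality for Phi(., y) gives sum_j u_j(y)^2 <= Phi(y, y) = phi(0). *)

(** * Finite sums and diagonal matrices *)

Lemma CauchySchwarz_sum (R : realDomainType) (I : finType) (P : pred I)
    (a b : I -> R) :
  (\sum_(i | P i) a i * b i) ^+ 2 <=
  (\sum_(i | P i) a i ^+ 2) * (\sum_(i | P i) b i ^+ 2).
Proof.
have E (c d : I -> R) : (\sum_(i | P i) c i) * (\sum_(j | P j) d j) =
    \sum_(i | P i) \sum_(j | P j) c i * d j.
  by rewrite mulr_suml; apply: eq_bigr => i _; rewrite mulr_sumr.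
(* Lagrange's identity *)
have L i j : (a i * b j - a j * b i) ^+ 2 =
    a i ^+ 2 * b j ^+ 2 + b i ^+ 2 * a j ^+ 2 - (a i * b i) * (a j * b j) *+ 2.
  by ring.
(* Summed over both indices, these squares give twice the difference of the two sides. *)
have : 0 <= \sum_(i | P i) \sum_(j | P j) (a i * b j - a j * b i) ^+ 2.
  by do 2![apply: sumr_ge0 => ? _]; exact: sqr_ge0.
under eq_bigr => i _ do under eq_bigr => j _ do rewrite L.
under eq_bigr => i _ do rewrite sumrB big_split sumrMnl /=.
rewrite sumrB big_split sumrMnl /= -!E [X in _ + X - _]mulrC -mulr2n -mulrnBl.
by rewrite pmulrn_lge0// subr_ge0 -expr2.
Qed.

Lemma diagf_sqrt_sqr {R : realType} {N : nat} (w : 'I_N -> R) :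
  (forall i, 0 < w i) ->
  diagf (fun i => Num.sqrt (w i)) *m diagf (fun i => Num.sqrt (w i)) = diagf w.
Proof.
move=> w0; rewrite diagf_mul; congr diagf; apply/funext => i.
by rewrite -expr2 sqr_sqrtr// ltW.
Qed.

Lemma diagf_unit {R : realType} {N : nat} (a : 'I_N -> R) :
  (forall i, 0 < a i) -> diagf a \in unitmx.
Proof.
move=> a0; rewrite unitmxE det_diag unitfE; apply/prodf_neq0 => i _.
by rewrite mxE gt_eqF.
Qed.

(** * Linear algebra in the native space *)

Section NativeSpace.
Context {R : realType} {T : Type} {K : T -> T -> R} (H : native_space K).
Local Notation ip := (native_ip H).
Local Notation car := (native_carrier H).

Lemma native_carrierD {f g} : car f -> car g -> car (f + g).
Proof. by move=> fH gH; rewrite -[f]scale1r; exact: native_lin. Qed.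

Lemma native_carrierZ a {f} : car f -> car (a *: f).
Proof. by move=> fH; rewrite -[_ *: _]addr0; exact: native_lin (native_0 H). Qed.

Lemma native_carrierB {f g} : car f -> car g -> car (f - g).
Proof.
by move=> fH gH; rewrite -scaleN1r; apply/native_carrierD/native_carrierZ.
Qed.

Lemma native_carrier_comb {I : finType} (P : pred I) (c : I -> R) (v : I -> T -> R) :
  (forall i, car (v i)) -> car (\sum_(i | P i) c i *: v i).
Proof.
move=> vH; apply: big_ind; first exact: native_0.
  by move=> f g; exact: native_carrierD.
by move=> i _; exact: native_carrierZ.
Qed.

Lemma native_ip0l {f} : car f -> ip 0 f = 0.
Proof.
(* Linearity at [1 *: 0 + 0] gives [ip 0 f = ip 0 f + ip 0 f]. *)
move=> fH; have := native_ip_lin 1 (native_0 H) (native_0 H) fH.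
by rewrite scaler0 addr0 mul1r => /(congr1 (fun t => t - ip 0 f)); rewrite subrr addrK.
Qed.

Lemma native_ipDl {f g h} : car f -> car g -> car h -> ip (f + g) h = ip f h + ip g h.
Proof.
by move=> fH gH hH; rewrite -{1}[f]scale1r native_ip_lin// mul1r.
Qed.

Lemma native_ipZl a {f h} : car f -> car h -> ip (a *: f) h = a * ip f h.
Proof.
move=> fH hH; rewrite -[_ *: _]addr0 native_ip_lin ?native_ip0l ?addr0//.
exact: native_0.
Qed.

Lemma native_ipBl {f g h} : car f -> car g -> car h -> ip (f - g) h = ip f h - ip g h.
Proof.
move=> fH gH hH; rewrite -scaleN1r native_ipDl ?native_ipZl ?mulN1r//.
exact: native_carrierZ.
Qed.

Lemma native_ip_ge0 {f} : car f -> 0 <= ip f f.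
Proof.
move=> fH; have [->|f0] := eqVneq f 0; first by rewrite native_ip0l//; exact: native_0.
exact/ltW/native_ip_gt0.
Qed.

Lemma native_ip_combl {I : finType} (P : pred I) (c : I -> R) (v : I -> T -> R) {f} :
  (forall i, car (v i)) -> car f ->
  ip (\sum_(i | P i) c i *: v i) f = \sum_(i | P i) c i * ip (v i) f.
Proof.
move=> vH fH.
(* Since [ip] is additive only on the carrier, the induction carries membership along with the
   value. *)
pose E g r := car g /\ ip g f = r.
suff [] : E (\sum_(i | P i) c i *: v i) (\sum_(i | P i) c i * ip (v i) f) by [].
apply: (big_ind2 E) => [|g r h s [gH <-] [hH <-]|i _].
- by split; [exact: native_0|exact: native_ip0l].
- by split; [exact: native_carrierD|exact: native_ipDl].
- by split; [exact: native_carrierZ|exact: native_ipZl].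
Qed.

Lemma native_ip_combr {I : finType} (P : pred I) (c : I -> R) (v : I -> T -> R) {f} :
  (forall i, car (v i)) -> car f ->
  ip f (\sum_(i | P i) c i *: v i) = \sum_(i | P i) c i * ip f (v i).
Proof.
move=> vH fH; rewrite native_ip_sym//; last exact: native_carrier_comb.
rewrite native_ip_combl//; apply: eq_bigr => i _.
by rewrite native_ip_sym.
Qed.

(** * Fourier sums over a finite orthonormal family *)

Section Orthonormal.
Context {I : finType} {v : I -> T -> R}.
Hypothesis vH : forall i, car (v i).
Hypothesis vv : forall i j, ip (v i) (v j) = (i == j)%:R.

(** For [f] in the carrier and orthonormal [v], this is the native-orthogonal projection of [f]; [P]
    selects either the full family or an initial segment. *)
Definition fourier_sum (P : pred I) (f : T -> R) : T -> R :=
  \sum_(i | P i) ip f (v i) *: v i.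

Lemma fourier_sum_carrier P f : car (fourier_sum P f).
Proof. exact: native_carrier_comb. Qed.

Lemma ip_fourier_sum (P : pred I) f i : P i -> ip (fourier_sum P f) (v i) = ip f (v i).
Proof.
move=> Pi; rewrite native_ip_combl// (bigD1 i)//= vv eqxx mulr1 big1 ?addr0//.
by move=> j /andP[_ /negbTE ji]; rewrite vv ji mulr0.
Qed.

(** With [p] the Fourier sum, [ip f p] and [ip p p] both equal [s], so the squared norm of [f - p]
    is [ip f f - s]. *)
Lemma bessel (P : pred I) f : car f -> \sum_(i | P i) ip f (v i) ^+ 2 <= ip f f.
Proof.
move=> fH; set s := \sum_(i | P i) _; set p := fourier_sum P f.
have pH : car p by exact: fourier_sum_carrier.
have ffp : ip f p = s by rewrite native_ip_combr.
have pp : ip p p = s.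
  rewrite {2}/p native_ip_combr//; apply: eq_bigr => i Pi.
  by rewrite ip_fourier_sum.
have dH : car (f - p) by exact: native_carrierB.
have := native_ip_ge0 dH.
rewrite native_ipBl// !(native_ip_sym _ dH)// !native_ipBl//.
by rewrite (native_ip_sym pH fH) ffp pp subrr subr0 subr_ge0.
Qed.

Lemma fourier_sum_le (P : pred I) f y : car f ->
  `|fourier_sum P f y| <= Num.sqrt (\sum_(i | P i) v i y ^+ 2) * native_norm H f.
Proof.
move=> fH; rewrite /native_norm -sqrtrM; last by apply: sumr_ge0 => i _; exact: sqr_ge0.
rewrite -sqrtr_sqr; apply: ler_wsqrtr.
have -> : fourier_sum P f y = \sum_(i | P i) ip f (v i) * v i y.
  by rewrite /fourier_sum fct_sumE.
apply: le_trans (CauchySchwarz_sum P (fun i => ip f (v i)) (v ^~ y)) _.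
rewrite mulrC; apply: ler_wpM2l; last exact: bessel.
by apply: sumr_ge0 => i _; exact: sqr_ge0.
Qed.

(** By the reproducing property, [K^~ y] has Fourier coefficients [v i y] and squared norm
    [K y y]. *)
Lemma orthonormal_sum_sqr_le (P : pred I) y : \sum_(i | P i) v i y ^+ 2 <= K y y.
Proof.
have kH := native_kernel H y.
rewrite -(native_repr y kH); apply: le_trans (bessel P kH).
by apply: ler_sum => i _; rewrite native_ip_sym// native_repr.
Qed.

End Orthonormal.

(** * The weighted SVD basis and its two approximants *)

Section WeightedSVD.
Context {N : nat} {x : 'I_N -> T} {w : 'I_N -> R} {u : 'I_N -> T -> R}.
Hypotheses (Kpos : posdef_kernel K) (x_inj : injective x) (w_gt0 : forall i, 0 < w i).

Context {Q : 'M[R]_N} {sigma : 'I_N -> R}.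
Hypothesis svd : weighted_svd K x w Q sigma.
Let C := diagf (fun i => Num.sqrt (w i)) *m Q *m invmx (diagf sigma).
Hypothesis uE : forall j, u j = \sum_i C i j *: K^~ (x i).
Let A := kernel_mx K x.

Lemma svd_basis_carrier j : car (u j).
Proof. by rewrite uE; apply: native_carrier_comb => i; exact: native_kernel. Qed.

(** The reproducing property turns products with kernel translates into point values, so the Fourier
    coefficients of [f] depend only on its data at the points. *)
Lemma ip_svd_basis f j : car f -> ip f (u j) = ((\row_i f (x i)) *m C) ord0 j.
Proof.
move=> fH; rewrite uE native_ip_combr//; last by move=> i; exact: native_kernel.
rewrite [RHS]mxE; apply: eq_bigr => i _.
by rewrite native_repr// [X in _ = X * _]mxE mulrC.
Qed.

Lemma svd_basis_at i j : u j (x i) = (A *m C) i j.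
Proof.
by rewrite uE combE [RHS]mxE; apply: eq_bigr => k _; rewrite [A i k]mxE mulrC.
Qed.

(** Both sides reduce to [S *m Q *m diagf sigma], where [S] is the square root of [diagf w]: the
    columns of [C] are eigenvectors of [diagf w *m A]. *)
Lemma svd_diag_kernel_coef : diagf w *m A *m C = C *m (diagf sigma *m diagf sigma).
Proof.
have [QQ _ sg0 SAS] := svd; have sgU := diagf_unit sg0.
rewrite -(diagf_sqrt_sqr w_gt0) /C; set S := diagf _ in SAS *.
rewrite (_ : _ *m _ = S *m (S *m A *m S) *m Q *m invmx (diagf sigma)); last first.
  by rewrite !mulmxA.
rewrite SAS !mulmxA -[_ *m Q^T *m Q]mulmxA QQ mulmx1 !mulmxK//.
by rewrite mulmxKV.
Qed.

(** The factors of [C] rebuild [S *m A *m S] in the middle; its diagonalization cancels [Q] and then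
    [sigma]. *)
Lemma svd_coef_kernel_coef : C^T *m A *m C = 1%:M.
Proof.
have [QQ _ sg0 SAS] := svd; have sgU := diagf_unit sg0.
have IT : (invmx (diagf sigma))^T = invmx (diagf sigma).
  by rewrite diagf_inv// tr_diag_mx.
rewrite /C !trmx_mul IT; set S := diagf _ in SAS *.
have -> : S^T = S by exact: tr_diag_mx.
rewrite (_ : _ *m _ = invmx (diagf sigma) *m Q^T *m (S *m A *m S) *m Q
  *m invmx (diagf sigma)); last by rewrite !mulmxA.
rewrite SAS !mulmxA -[_ *m Q^T *m Q]mulmxA QQ mulmx1 -[_ *m Q^T *m Q]mulmxA QQ mulmx1.
by rewrite mulVmx// mul1mx mulmxV.
Qed.

(** The point values of the basis form [A *m C], so its Gram matrix is [(A *m C)^T *m C], which is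
    [C^T *m A *m C] by symmetry of [A]. *)
Lemma svd_basis_orthonormal i j : ip (u i) (u j) = (i == j)%:R.
Proof.
rewrite ip_svd_basis; last exact: svd_basis_carrier.
have <- : (C^T *m A *m C) i j = (i == j)%:R by rewrite svd_coef_kernel_coef mxE.
have [Asym _] := Kpos x_inj.
rewrite !mxE; apply: eq_bigr => k _; congr (_ * _).
by rewrite [LHS]mxE svd_basis_at -[A in RHS]Asym -trmx_mul [RHS]mxE.
Qed.

(** This transfers orthogonality to [u j] from the native to the discrete product, so that a native
    projection solves the least-squares problem. *)
Lemma wip_svd_basis f j : car f -> wip x w f (u j) = sigma j ^+ 2 * ip f (u j).
Proof.
move=> fH; rewrite ip_svd_basis// [X in _ * X]mxE mulr_sumr; apply: eq_bigr => i _.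
have := congr1 (fun B : 'M[R]_N => B i j) svd_diag_kernel_coef.
rewrite diagf_mul /diagf mul_mx_diag -mulmxA mul_diag_mx.
rewrite 2!mxE [X in _ = X]mxE !mxE => E.
rewrite svd_basis_at mulrAC mxE E; ring.
Qed.

Lemma interpolant_fourier f : car f -> interpolant K x f = fourier_sum (v := u) predT f.
Proof.
move=> fH; set g := fourier_sum _ _.
suff: is_interpolant K x f g by rewrite (interpolant_unique f Kpos x_inj) => ->.
have gH : car g by apply: fourier_sum_carrier svd_basis_carrier _ _.
split.
  exists (fun i => \sum_j ip f (u j) * C i j); rewrite /g /fourier_sum.
  under eq_bigr => j _ do rewrite {2}uE scaler_sumr.
  rewrite exchange_big; apply: eq_bigr => i _; rewrite scaler_suml.
  by apply: eq_bigr => j _; rewrite scalerA.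
(* Since [C] is invertible, equal Fourier coefficients force equal values at the points. *)
have [_ CU] := mulmx1_unit svd_coef_kernel_coef.
have : (\row_i g (x i)) *m C = (\row_i f (x i)) *m C.
  apply/rowP => j; rewrite -!ip_svd_basis//.
  exact: ip_fourier_sum svd_basis_carrier svd_basis_orthonormal _ _ _ _.
move=> /(can_inj (mulmxK CU)) /rowP gf i.
by have := gf i; rewrite !mxE.
Qed.

Lemma wls_approx_fourier M f : car f ->
  wls_approx x w u M f = fourier_sum (v := u) (fun j : 'I_N => (j < M)%N) f.
Proof.
move=> fH; set g := fourier_sum _ _.
have usvd : weighted_svd_basis K x w u by exists Q, sigma.
suff: is_wls x w u M f g by rewrite (wls_approx_unique M f Kpos x_inj w_gt0 usvd) => ->.
have gH : car g by apply: fourier_sum_carrier svd_basis_carrier _ _.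
have wge0 h : 0 <= wip x w h h.
  by apply: sumr_ge0 => i _; rewrite -mulrA -expr2 mulr_ge0 ?sqr_ge0// ltW.
split; first by exists (fun j => ip f (u j)).
move=> _ [d ->]; apply: ler_wsqrtr.
(* [e] is [g] minus the competitor. The residual [f - g] is discretely orthogonal to it, so
   Pythagoras applies. *)
set e := \sum_(j < N | (j < M)%N) (ip f (u j) - d j) *: u j.
rewrite (_ : f - \sum_(j < N | _) d j *: _ = f - g + e); last first.
  rewrite /e; under [in RHS]eq_bigr => j _ do rewrite scalerBl.
  by rewrite sumrB -[X in _ + (X - _)]/g addrA subrK.
rewrite [leRHS]wip_pyth ?lerDl// wip_comb big1// => j jM.
rewrite wip_svd_basis; last exact: native_carrierB.
rewrite native_ipBl//; last exact: svd_basis_carrier.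
rewrite [ip g _](ip_fourier_sum svd_basis_carrier svd_basis_orthonormal)//.
by rewrite subrr !mulr0.
Qed.

End WeightedSVD.
End NativeSpace.

Theorem proposition3p9 (R : realType) (n : nat) (n_gt0 : (0 < n)%N)
    (Omega : set 'rV[R]_n)
    (Omega_bounded : bounded_set Omega)
    (Omega_measurable : lebesgue_measurable Omega)
    (phi : R -> R) (Phi : Omega -> Omega -> R)
    (Phi_continuous : continuous (fun p : Omega * Omega => Phi p.1 p.2))
    (Phi_symmetric : forall y z, Phi y z = Phi z y)
    (Phi_radial : forall y z, Phi y z = phi (enorm (val y - val z)))
    (Phi_posdef : posdef_kernel Phi)
    (H : native_space Phi)
    (N : nat) (x : 'I_N -> Omega) (x_inj : injective x)
    (w : 'I_N -> R) (w_gt0 : forall i, 0 < w i)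
    (w_exact : (\sum_(i < N) w i)%:E = lebesgue_outer Omega)
    (u : 'I_N -> Omega -> R) (u_svd : weighted_svd_basis Phi x w u)
    (M : nat) (le_M_N : (M <= N)%N)
    (f : Omega -> R) (f_native : native_carrier H f) :
  forall y : Omega,
    [/\ `|interpolant Phi x f y| <= Num.sqrt (phi 0) * native_norm H f,
        `|wls_approx x w u M f y| <= Num.sqrt (phi 0) * native_norm H f,
        `|interpolant Phi x f y|
          <= Num.sqrt (\sum_(j < N) u j y ^+ 2) * native_norm H f &
        `|wls_approx x w u M f y|
          <= Num.sqrt (\sum_(j < N | (j < M)%N) u j y ^+ 2) * native_norm H f].
Proof.
move=> y; have [Q [sigma [svd uE]]] := u_svd.
have uH := svd_basis_carrier H uE.
have uu := svd_basis_orthonormal H Phi_posdef x_inj svd uE.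
have phi0 : Phi y y = phi 0.
  rewrite Phi_radial subrr /enorm big1 ?sqrtr0// => i _.
  by rewrite mxE expr0n.
(* The bounds with [phi 0] follow from those with the basis functions, because the sum of squares is
   at most [Phi y y]. *)
have le0 (P : pred 'I_N) : Num.sqrt (\sum_(j | P j) u j y ^+ 2) * native_norm H f <=
    Num.sqrt (phi 0) * native_norm H f.
  apply: ler_wpM2r; first exact: sqrtr_ge0.
  by rewrite -phi0; apply: ler_wsqrtr; exact: orthonormal_sum_sqr_le uH uu _ _.
have le1 P := fourier_sum_le uH uu P y f_native.
rewrite (interpolant_fourier Phi_posdef x_inj svd uE f_native).
rewrite (wls_approx_fourier Phi_posdef x_inj w_gt0 svd uE M f_native).
by split=> //; exact: le_trans (le1 _) (le0 _).
Qed.
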